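(* Let $K_{\mathrm{ipf}}$ be the class of structures in which each relation is an injective partial function, and let $O$ be any first-order definable operation on binary relations. The following are equivalent: (1) $O$ is injective-function preserving and local over $K_{\mathrm{ipf}}$; (2) $O$ is term definable in $\mathbb{BRA}(\circ,{\sim},\cap,{}^\smile,\mathbin{\sqcup^1})$ over $K_{\mathrm{ipf}}$.
   Context: Structures are over a signature $\{R_1,\dots,R_n\}$ of binary relation symbols. An $n$-ary operation on binary relations is an isomorphism-invariant map $O$ sending each structure $A$ to a relation $O(A)\subseteq\mathrm{dom}(A)^2$; it is first-order definable if given by a first-order formula $\phi(x,y)$. $O$ is injective-function preserving if whenever every $R_i^A$ is an injective partial function on $\mathrm{dom}(A)$, $O(A)$ is an injective partial function on $\mathrm{dom}(A)$. For $a\in\mathrm{dom}(A)$, $A^{\leftrightarrow}_a$ is the induced substructure of $A$ on all elements reachable from $a$ by a finite undirected path along $R_1^A,\dots,R_n^A$ (edges may be traversed in either direction); $O$ is local over a class $K$ if for all $A\in K$ and $a,b\in\mathrm{dom}(A)$: $(a,b)\in O(A)$ iff $(a,b)\in O(A^{\leftrightarrow}_a)$. $\mathbb{BRA}(\mathcal{O})$ has as terms the expressions built from $R_1,\dots,R_n$ using operations in $\mathcal{O}$; $O$ is term definable over $K$ if some term defines the same relation as $O$ on every structure in $K$. Operations: $\circ$ composition; ${\sim}R=\{(x,x)\mid\neg\exists y\,R(x,y)\}$ (antidomain); $\cap$ intersection; ${}^\smile$ inverse; $R\sqcup S=R\cup\{(x,y)\in S\mid\neg\exists z\,R(x,z)\}$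 (preferential union); injective union $f\mathbin{\sqcup^1} g:=(f\sqcup g)\cap(f^\smile\sqcup g^\smile)^\smile$. *)

(* Defs.v *)
From mathcomp Require Import all_boot.
From Stdlib Require Import Relation_Operators.

Set Implicit Arguments.
Unset Strict Implicit.
Unset Printing Implicit Defensive.

(* Structures over the signature {R_i | i : 'I_n}, of arbitrary cardinality. *)
Record structure (n : nat) := Structure {
  dom : Type;
  rel_of : 'I_n -> dom -> dom -> Prop
}.

Definition isomorphism n (A B : structure n) (f : dom A -> dom B) : Prop :=
  bijective f /\
  forall i x y, rel_of (s := A) i x y <-> rel_of (s := B) i (f x) (f y).

Record operation (n : nat) := Operation {
  op_rel :> forall A : structure n, dom A -> dom A -> Prop;
  op_iso : forall (A B : structure n) (f : dom A -> dom B),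
    isomorphism f -> forall x y, op_rel x y <-> op_rel (f x) (f y)
}.

(* [fo n m] is the type of first-order formulas with equality whose free
   variables are among m variables, in well-scoped de Bruijn form: in the body
   of [FoEx], variable [ord0] is the bound one and [lift ord0 i] is the outer
   variable i. The other connectives are definable classically. *)
Inductive fo (n : nat) : nat -> Type :=
| FoEq m (i j : 'I_m) : fo n m
| FoRel m (k : 'I_n) (i j : 'I_m) : fo n m
| FoNot m (p : fo n m) : fo n m
| FoAnd m (p q : fo n m) : fo n m
| FoEx m (p : fo n m.+1) : fo n m.

Definition extend (T : Type) m (a : T) (v : 'I_m -> T) (i : 'I_m.+1) : T :=
  if unlift ord0 i is Some j then v j else a.

Fixpoint sat n (A : structure n) m (p : fo n m) : ('I_m -> dom A) -> Prop :=
  match p in fo _ m return ('I_m -> dom A) -> Prop with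
  | FoEq _ i j => fun v => v i = v j
  | FoRel _ k i j => fun v => rel_of (s := A) k (v i) (v j)
  | FoNot _ p => fun v => ~ sat p v
  | FoAnd _ p q => fun v => sat p v /\ sat q v
  | FoEx _ p => fun v => exists a : dom A, sat p (extend a v)
  end.

Definition fo_definable n (O : operation n) : Prop :=
  exists p : fo n 2, forall (A : structure n) (x y : dom A),
    O A x y <-> sat p (fun i : 'I_2 => if i == ord0 then x else y).

Definition injective_pfun (T : Type) (R : T -> T -> Prop) : Prop :=
  (forall x y z, R x y -> R x z -> y = z) /\
  (forall x y z, R x z -> R y z -> x = y).

Definition K_ipf n (A : structure n) : Prop :=
  forall i, injective_pfun (@rel_of n A i).

Definition injective_function_preserving n (O : operation n) : Prop :=
  forall A : structure n, K_ipf A -> injective_pfun (O A).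

Definition induced n (A : structure n) (P : dom A -> Prop) : structure n :=
  @Structure n {x : dom A | P x}
    (fun i x y => rel_of (s := A) i (proj1_sig x) (proj1_sig y)).

Definition adjacent n (A : structure n) (x y : dom A) : Prop :=
  exists i, rel_of (s := A) i x y \/ rel_of (s := A) i y x.

Definition reachable n (A : structure n) (a : dom A) : dom A -> Prop :=
  clos_refl_trans (dom A) (@adjacent n A) a.

(* The value of O on the induced substructure, as a relation on [dom A]; it
   holds only between elements of the substructure. *)
Definition op_induced n (O : operation n) (A : structure n)
    (P : dom A -> Prop) (x y : dom A) : Prop :=
  exists (hx : P x) (hy : P y), O (induced P) (exist P x hx) (exist P y hy).

Definition local_over n (K : structure n -> Prop) (O : operation n) : Prop :=
  forall A : structure n, K A -> forall a b : dom A,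
    O A a b <-> op_induced O (reachable a) a b.

Section RelationOperations.
Variable T : Type.
Implicit Types R S : T -> T -> Prop.

Definition rcomp R S (x y : T) : Prop := exists z, R x z /\ S z y.
Definition antidomain R (x y : T) : Prop := x = y /\ ~ exists z, R x z.
Definition rcap R S (x y : T) : Prop := R x y /\ S x y.
Definition rconv R (x y : T) : Prop := R y x.
Definition pref_union R S (x y : T) : Prop :=
  R x y \/ (S x y /\ ~ exists z, R x z).
Definition inj_union R S : T -> T -> Prop :=
  rcap (pref_union R S) (rconv (pref_union (rconv R) (rconv S))).

End RelationOperations.

Inductive term (n : nat) : Type :=
| TRel (i : 'I_n)
| TComp (s t : term n)
| TAntidomain (t : term n)
| TCap (s t : term n)
| TConv (t : term n)
| TInjUnion (s t : term n).

Fixpoint term_rel n (A : structure n) (t : term n) : dom A -> dom A -> Prop :=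
  match t with
  | TRel i => @rel_of n A i
  | TComp s t => rcomp (term_rel s) (term_rel t)
  | TAntidomain t => antidomain (term_rel t)
  | TCap s t => rcap (term_rel s) (term_rel t)
  | TConv t => rconv (term_rel t)
  | TInjUnion s t => inj_union (term_rel s) (term_rel t)
  end.

Definition term_definable_over n (K : structure n -> Prop) (O : operation n)
    : Prop :=
  exists t : term n, forall A : structure n, K A ->
    forall x y : dom A, O A x y <-> term_rel t x y.

(* Main.v *)
(** Over injective partial functions a pair (a, b) is described up to radius r
    by the words of length at most r, in the relations and their inverses,
    that lead from one of a, b to one of a, b. In a structure containing
    infinitely many disjoint copies of each of its components, an
    Ehrenfeucht-Fraisse argument shows that this description, for r = 3 ^ q,
    decides all formulas of quantifier depth q: a point far from the tuple is
    answered in a fresh copy. Locality lets any two structures be placed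
    together in such a structure, so O (a, b) depends only on the description
    of (a, b); since O is functional, b must be at distance at most r from a,
    as otherwise it could be moved to another copy. Hence O is a finite union
    of terms "check which words are loops at a, then follow a word w", and as
    this union is an injective partial function it is an injective union. *)
Require Import Defs.
From mathcomp Require Import all_boot.
From mathcomp Require Import boolp.
From Stdlib Require Import Relation_Operators.

Set Implicit Arguments.
Unset Strict Implicit.
Unset Printing Implicit Defensive.

(** * Words in the relations and their inverses *)

Section Words.
Variable n : nat.
Implicit Types (A : structure n) (l : 'I_n * bool) (w : seq ('I_n * bool)).

Definition letter A l (x y : dom A) : Prop :=
  if l.2 then rel_of (s := A) l.1 x y else rel_of (s := A) l.1 y x.

Definition word A w : dom A -> dom A -> Prop :=
  foldr (fun l => rcomp (letter l)) eq w.

Definition word_inv w := rev [seq (l.1, ~~ l.2) | l <- w].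

Lemma size_word_inv w : size (word_inv w) = size w.
Proof. by rewrite size_rev size_map. Qed.

Lemma word_cat A u w (x y : dom A) :
  word (u ++ w) x y <-> exists2 z, word u x z & word w z y.
Proof.
elim: u x => [|l u IHu] x /=; first by split=> [|[_ <-]] //; exists x.
split=> [[z [lxz /IHu[t uzt wty]]]|[t [z [lxz uzt]] wty]].
  by exists t => //; exists z.
by exists z; split=> //; apply/IHu; exists t.
Qed.

Lemma word_invP A w (x y : dom A) : word (word_inv w) x y <-> word w y x.
Proof.
have letter_flip l s t : letter (A := A) (l.1, ~~ l.2) s t <-> letter l t s.
  by case: l => i [].
elim: w x y => [|l w IHw] x y /=; first by split=> ->.
rewrite /word_inv /= rev_cons -cats1; split.
  by move=> /word_cat[z /IHw wzx [t [/letter_flip lyz <-]]]; exists z.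
move=> [z [lyz wzx]]; apply/word_cat; exists z; first exact/IHw.
by exists y; split=> //; apply/letter_flip.
Qed.

Lemma word_functional A w (x y z : dom A) :
  K_ipf A -> word w x y -> word w x z -> y = z.
Proof.
move=> KA; elim: w x => [|[i b] w IHw] x /=; first by move=> -> ->.
move=> [s [lxs wsy]] [t [lxt wtz]].
suff st : s = t by apply: IHw wsy _; rewrite st.
case: b lxs lxt; rewrite /letter /= => lxs lxt.
- exact: (KA i).1 lxs lxt.
- exact: (KA i).2 lxs lxt.
Qed.

(** Words are functional here, so [x] and [y] are the only ends of [p] from [x0] and of [q] from
    [y0]: a path along [p ++ u ++ word_inv q] must pass through them. *)
Lemma word_conj A p q u (x0 y0 x y : dom A) : K_ipf A ->
  word p x0 x -> word q y0 y ->
  (word u x y <-> word (p ++ u ++ word_inv q) x0 y0).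
Proof.
move=> KA px qy; split=> [uxy|].
  apply/word_cat; exists x => //; apply/word_cat; exists y => //.
  exact/word_invP.
move=> /word_cat[x' px' /word_cat[y' ux'y' /word_invP qy']].
by rewrite (word_functional KA px px') (word_functional KA qy qy').
Qed.

(** The case [i = j] records loops, and the empty word records equalities. *)
Definition similar A B r m (v : 'I_m -> dom A) (v' : 'I_m -> dom B) : Prop :=
  forall i j w, size w <= r -> (word w (v i) (v j) <-> word w (v' i) (v' j)).

(* The words [p k ++ w ++ word_inv (p l)] have length at most 3 r. *)
Lemma similar_paths A B r m m' (v : 'I_m -> dom A) (v' : 'I_m -> dom B)
    (s : 'I_m' -> dom A) (s' : 'I_m' -> dom B) (g : 'I_m' -> 'I_m)
    (p : 'I_m' -> seq ('I_n * bool)) :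
  K_ipf A -> K_ipf B -> similar (3 * r) v v' -> (forall k, size (p k) <= r) ->
  (forall k, word (p k) (v (g k)) (s k)) ->
  (forall k, word (p k) (v' (g k)) (s' k)) ->
  similar r s s'.
Proof.
move=> KA KB vv' pr ps ps' k l w wr.
apply: iff_trans (word_conj w KA (ps k) (ps l)) _.
apply: iff_trans (iff_sym (word_conj w KB (ps' k) (ps' l))).
apply: vv'; rewrite !size_cat size_word_inv.
by rewrite !mulSn mul0n addn0 !leq_add.
Qed.

End Words.

(** * The Ehrenfeucht-Fraisse game in rich structures *)

Section Game.
Variable n : nat.
Implicit Types A M : structure n.

Fixpoint quantifier_depth m (p : fo n m) : nat :=
  match p with
  | FoEq _ _ _ | FoRel _ _ _ _ => 0
  | FoNot _ p => quantifier_depth p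
  | FoAnd _ p q => maxn (quantifier_depth p) (quantifier_depth q)
  | FoEx _ p => (quantifier_depth p).+1
  end.

Lemma extend0 T m (a : T) (v : 'I_m -> T) : extend a v ord0 = a.
Proof. by rewrite /extend unlift_none. Qed.

Lemma extend_lift T m (a : T) (v : 'I_m -> T) j :
  extend a v (lift ord0 j) = v j.
Proof. by rewrite /extend liftK. Qed.

Lemma similar_sym A B r m (v : 'I_m -> dom A) (v' : 'I_m -> dom B) :
  similar r v v' -> similar r v' v.
Proof. by move=> vv' i j w wr; apply: iff_sym; apply: vv'. Qed.

Lemma similar_leq A B r r' m (v : 'I_m -> dom A) (v' : 'I_m -> dom B) :
  r <= r' -> similar r' v v' -> similar r v v'.
Proof. by move=> rr' vv' i j w wr; apply: vv'; apply: leq_trans rr'. Qed.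

(** What the game uses of infinitely many copies of each component. As no word leads from the tuple
    to [c'], only the loops at [c'] have to agree with those at [c]. *)
Definition rich M : Prop :=
  forall m (v : 'I_m -> dom M) (c : dom M), exists c' : dom M,
    (forall w, word w c c <-> word w c' c') /\
    (forall i w, ~ word w (v i) c').

(** A point within distance [r] of the tuple is answered by following the same word from the
    matching entry, any other point by richness. *)
Lemma similar_extend M r m (v v' : 'I_m -> dom M) c : K_ipf M -> rich M ->
  similar (3 * r) v v' -> exists c', similar r (extend c v) (extend c' v').
Proof.
move=> KM richM vv'.
have [[i [u [ur uc]]]|far] := EM (exists i u, size u <= r /\ word u (v i) c).
  (* The round trip along [u] is a loop at [v i]. It transfers to [v' i], so [u] can be followed
     from there; its end is the answer. *)
  have uu : size (u ++ word_inv u) <= 3 * r.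
    by rewrite size_cat size_word_inv addnn -mul2n; apply: leq_mul.
  have : word (u ++ word_inv u) (v' i) (v' i).
    by apply/vv'; [|apply/word_cat; exists c => //; apply/word_invP].
  move=> /word_cat[c' uc' _]; exists c'.
  (* Old entries are reached from themselves by the empty word, the new one from entry [i] by [u];
     the default of [odflt] serves the new index [ord0]. *)
  apply: (similar_paths (g := fun k => odflt i (unlift ord0 k))
    (p := fun k => if unlift ord0 k is Some _ then [::] else u) KM KM vv') => k.
  - by case: (unlift _ _).
  - by rewrite /extend; case: (unlift _ _).
  - by rewrite /extend; case: (unlift _ _).
have [c' [cc' far']] := richM m v' c; exists c' => k l w wr.
have [k'|] := unliftP ord0 k => ->; have [l'|] := unliftP ord0 l => ->;
  rewrite ?extend0 ?extend_lift.
- by apply: vv'; apply: leq_trans wr _; apply: leq_pmull.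
- by split=> [wc|/far'//]; case: far; exists k', w.
- split=> [/word_invP wc|/word_invP/far'//].
  by case: far; exists l', (word_inv w); rewrite size_word_inv.
- exact: cc'.
Qed.

(** Depth 0 has radius 1, enough for equality (the empty word) and for a relation symbol (one
    letter). Each quantifier divides the radius by 3. *)
Lemma similar_sat M m (p : fo n m) (v v' : 'I_m -> dom M) :
  K_ipf M -> rich M -> similar (3 ^ quantifier_depth p) v v' ->
  sat p v <-> sat p v'.
Proof.
move=> KM richM.
elim: p v v' => {m} [m i j|m k i j|m p IHp|m p IHp q IHq|m p IHp] v v' /= vv'.
- exact: (vv' i j [::]).
- have wordE x y : word [:: (k, true)] x y <-> rel_of (s := M) k x y.
    by split=> [[z [kxz <-]]|kxy] //; exists y.
  by rewrite -!wordE; apply: vv'.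
- by rewrite (IHp v v').
- by rewrite (IHp v v') 1?(IHq v v') //; apply: similar_leq vv';
    rewrite leq_exp2l // ?leq_maxl ?leq_maxr.
- rewrite expnS in vv'.
  split=> [[c pc]|[c pc]].
  + have [c' cc'] := similar_extend c KM richM vv'.
    by exists c'; apply/(IHp _ _ cc').
  + have [c' cc'] := similar_extend c KM richM (similar_sym vv').
    by exists c'; apply/(IHp _ _ cc').
Qed.

End Game.

(** * Invariance under embeddings of components *)

Section Components.
Variable n : nat.
Implicit Types A B : structure n.

(** An isomorphism onto a union of connected components: the last clause closes the image under
    adjacency. *)
Definition component_embedding A B (h : dom A -> dom B) : Prop :=
  [/\ injective h,
      forall i x y, rel_of (s := A) i x y <-> rel_of (s := B) i (h x) (h y) &
      forall x y', adjacent (h x) y' -> exists y, h y = y'].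

Section Embedding.
Variables (A B : structure n) (h : dom A -> dom B).
Hypothesis h_emb : component_embedding h.

Lemma embed_adjacent x y : adjacent x y <-> adjacent (h x) (h y).
Proof.
case: h_emb => _ relh _.
by split=> -[i [] /relh ?]; exists i; [left|right|left|right].
Qed.

Lemma embed_reachable a x : reachable a x -> reachable (h a) (h x).
Proof.
elim=> [y z yz|y|y z t _ yz _ zt]; first exact/rt_step/embed_adjacent.
  exact: rt_refl.
exact: rt_trans yz zt.
Qed.

Lemma reachable_embed a y' : reachable (h a) y' ->
  exists2 y, reachable a y & h y = y'.
Proof.
case: h_emb => _ _ closed; move ha: (h a) => a' ay'.
elim: ay' a ha => [x' t' xt' x hx|x' x hx|x' t' z' _ IHxt _ IHtz x hx].
- have [|y hy] := closed x t'; first by rewrite hx.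
  by exists y => //; apply/rt_step/embed_adjacent; rewrite hx hy.
- by exists x => //; apply: rt_refl.
- have [y xy hy] := IHxt _ hx; have [z yz hz] := IHtz _ hy.
  by exists z => //; apply: rt_trans yz.
Qed.

Lemma embed_term t x y : term_rel (A := A) t x y <-> term_rel t (h x) (h y).
Proof.
(* The second half says that terms do not lead out of the image; it pulls the witnesses of
   existentials back to [A]. Both directions are tracked because inverses exchange them. *)
suff [] : (forall x y, term_rel (A := A) t x y <-> term_rel t (h x) (h y)) /\
    (forall x y', (term_rel t (h x) y' \/ term_rel t y' (h x)) ->
      exists y, h y = y') by [].
case: h_emb => injh relh closed.
elim: t {x y} => [i|s [IHs Cs] t [IHt Ct]|t [IHt Ct]|s [IHs Cs] t [IHt Ct]
                 |t [IHt Ct]|s [IHs Cs] t [IHt Ct]] /=.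
- split=> [|x y' xy']; first exact: relh.
  by apply: (closed x); exists i.
- split=> [x y|x y' [[z' [xz zy]]|[z' [yz zx]]]].
  + split=> [[z [/IHs xz /IHt zy]]|[z' [xz zy]]]; first by exists (h z).
    have [z hz] := Cs x z' (or_introl xz); exists z.
    by split; [apply/IHs|apply/IHt]; rewrite hz.
  + have [z hz] := Cs x z' (or_introl xz).
    by apply: (Ct z); left; rewrite hz.
  + have [z hz] := Ct x z' (or_intror zx).
    by apply: (Cs z); right; rewrite hz.
- split=> [x y|x y' [[<- _]|[-> _]]]; last 2 first; try by exists x.
  split=> [[-> ndom]|[/injh-> ndom]]; split=> // -[z yz]; case: ndom.
    by have [z' hz] := Ct y z (or_introl yz); exists z'; apply/IHt; rewrite hz.
  by exists (h z); apply/IHt.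
- split=> [x y|x y' [[/or_introl/Cs//]|[/or_intror/Cs//]]].
  by split=> -[/IHs ? /IHt ?].
- by split=> [x y|x y' /or_comm/Ct//]; apply: IHt.
- have dom_s x : (exists z, term_rel s x z) <-> exists z, term_rel s (h x) z.
    split=> [[z /IHs xz]|[z' xz]]; first by exists (h z).
    have [z hz] := Cs x z' (or_introl xz).
    by exists z; apply/IHs; rewrite hz.
  have ran_s x : (exists z, term_rel s z x) <-> exists z, term_rel s z (h x).
    split=> [[z /IHs xz]|[z' xz]]; first by exists (h z).
    have [z hz] := Cs x z' (or_intror xz).
    by exists z; apply/IHs; rewrite hz.
  rewrite /inj_union /rcap /pref_union /rconv; split=> [x y|x y'].
    by rewrite IHs IHt dom_s ran_s.
  by move=> [[[/or_introl/Cs|[/or_introl/Ct]]]|[[/or_intror/Cs|[/or_intror/Ct]]]].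
Qed.

(** By locality the two sides can be evaluated in the components of [a] and [h a], between which [h]
    restricts to an isomorphism. *)
Lemma embed_local (O : operation n) a b :
  K_ipf A -> K_ipf B -> local_over (@K_ipf n) O ->
  O A a b <-> O B (h a) (h b).
Proof.
move=> KA KB locO; case: (h_emb) => injh relh _.
rewrite (locO A KA) (locO B KB).
pose f (s : dom (induced (reachable (A := A) a))) :
    dom (induced (reachable (h a))) :=
  exist _ (h (sval s)) (embed_reachable (proj2_sig s)).
have sig_eq (T : Type) (P : T -> Prop) (s t : {x | P x}) :
    sval s = sval t -> s = t.
  by case: s t => [x Px] [y Py] /= xy; subst y; rewrite (Prop_irrelevance Px Py).
have injf : injective f.
  by move=> s t /(congr1 sval)/injh/sig_eq.
have surjf (s : dom (induced (reachable (h a)))) : exists t, f t = s.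
  have [y ay hy] := reachable_embed (svalP s).
  by exists (exist _ y ay); apply: sig_eq.
(* Bijectivity asks for an inverse function, which choice extracts from surjectivity. *)
have [g fg] := choice surjf.
have isof : isomorphism f.
  split; first by exists g => // s; apply: injf; rewrite fg.
  by move=> i x y; apply: relh.
split=> [[aa [ab Oab]]|[ha [hb Oab]]].
  exists (embed_reachable aa), (embed_reachable ab).
  exact: (op_iso O isof _ _).1 Oab.
have [b' ab' /injh bb'] := reachable_embed hb.
rewrite bb' in ab'; exists (rt_refl _ _ _), ab'.
apply/(op_iso O isof); congr (op_rel O _ _): Oab; exact: sig_eq.
Qed.

End Embedding.

End Components.

(** * Terms for loop conditions and finite unions *)

Section Terms.
Variables (n : nat) (i0 : 'I_n).
Implicit Types A : structure n.

(** Terms have no constants, so the empty relation is built from some symbol [i0]: a point outside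
    the domain of a relation has no image under it. *)
Definition term_empty : term n := TComp (TAntidomain (TRel i0)) (TRel i0).
Definition term_id : term n := TAntidomain term_empty.

Lemma term_emptyE A x y : term_rel (A := A) term_empty x y <-> False.
Proof. by split=> // -[z [[<- ndom] xy]]; apply: ndom; exists y. Qed.

Lemma term_idE A x y : term_rel (A := A) term_id x y <-> x = y.
Proof. by split=> [[]|->] //; split=> // -[z /term_emptyE]. Qed.

Definition letter_term (l : 'I_n * bool) : term n :=
  if l.2 then TRel l.1 else TConv (TRel l.1).

Definition word_term (w : seq ('I_n * bool)) : term n :=
  foldr (fun l => TComp (letter_term l)) term_id w.

Lemma word_termE A w x y : term_rel (A := A) (word_term w) x y <-> word w x y.
Proof.
elim: w x => [|[i []] w IHw] x /=; first exact: term_idE.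
- by split=> -[z [xz /IHw zy]]; exists z.
- by split=> -[z [xz /IHw zy]]; exists z.
Qed.

Definition loop_term (w : seq ('I_n * bool)) : term n :=
  TCap (word_term w) term_id.

Lemma loop_termE A w x y :
  term_rel (A := A) (loop_term w) x y <-> x = y /\ word w x x.
Proof.
split=> [[/word_termE xy /term_idE E]|[<- xx]]; first by split=> //; rewrite {2}E.
by split; [apply/word_termE|apply/term_idE].
Qed.

(** Words of bounded length form a finite type, so only finitely many loop sets are possible. *)
Definition loops r A (x : dom A) : {set r.-bseq ('I_n * bool)} :=
  [set w : r.-bseq ('I_n * bool) | `[<word w x x>]].

(** A composition of partial identities, one test per bounded word; the antidomain negates a
    test. *)
Definition loops_term r (T : {set r.-bseq ('I_n * bool)}) : term n :=
  foldr (fun w : r.-bseq ('I_n * bool) => TComp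
    (if w \in T then loop_term w else TAntidomain (loop_term w)))
    term_id (enum {: r.-bseq ('I_n * bool)}).

Lemma loops_termE r A (T : {set r.-bseq ('I_n * bool)}) (x y : dom A) :
  term_rel (loops_term T) x y <-> x = y /\ loops r x = T.
Proof.
have testE (w : r.-bseq ('I_n * bool)) (z t : dom A) :
    term_rel (if w \in T then loop_term w else TAntidomain (loop_term w)) z t
    <-> z = t /\ (w \in loops r z) = (w \in T).
  rewrite inE; case: (w \in T); split.
  - by move=> /loop_termE[zt /asboolP].
  - by move=> [zt /asboolP zz]; apply/loop_termE.
  - move=> [zt nloop]; split=> //; apply/asboolP => zz.
    by apply: nloop; exists z; apply/loop_termE.
  - by move=> [zt /asboolP zz]; split=> // -[u /loop_termE[]].
suff foldE s : term_rel (foldr (fun w : r.-bseq ('I_n * bool) => TComp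
      (if w \in T then loop_term w else TAntidomain (loop_term w)))
      term_id s) x y <->
    x = y /\ forall w, w \in s -> (w \in loops r x) = (w \in T).
  apply: iff_trans (foldE _) _; split=> -[xy eqT]; split=> //.
    by apply/setP => w; apply: eqT; rewrite mem_enum.
  by move=> w _; rewrite eqT.
elim: s => [|w s IHs] /=.
  by split=> [/term_idE|[xy _]] //; apply/term_idE.
split=> [[z [/testE[<- eqw] /IHs[xy eqs]]]|[xy eqs]].
  by split=> // u; rewrite inE => /predU1P[->|/eqs].
exists x; split; first by apply/testE; rewrite eqs ?mem_head.
by apply/IHs; split=> // u us; rewrite eqs // inE us orbT.
Qed.

Definition union_term (I : Type) (f : I -> term n) (s : seq I) : term n :=
  foldr (fun k => TInjUnion (f k)) term_empty s.

(** An injective union drops a pair of its second argument only if the first already uses its source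
    or target. Inside one injective partial function [F] such a clash makes the two pairs equal, so
    nothing is lost. *)
Lemma union_termE (I : eqType) (f : I -> term n) (s : seq I) A
    (F : dom A -> dom A -> Prop) : injective_pfun F ->
  (forall k (x y : dom A), k \in s -> term_rel (f k) x y -> F x y) ->
  forall x y : dom A, term_rel (union_term f s) x y <->
    exists2 k, k \in s & term_rel (f k) x y.
Proof.
move=> [funF injF]; elim: s => [|k s IHs] sF x y /=.
  by split=> [/term_emptyE|[]].
have {}IHs := IHs (fun k' x y ks => sF k' x y (mem_behead (s := k :: s) ks)).
have subF u v : term_rel (union_term f s) u v -> F u v.
  by move=> /IHs[k' k's]; apply: sF; rewrite inE k's orbT.
have kF u v : term_rel (f k) u v -> F u v by apply: sF; rewrite mem_head.
have unionE : inj_union (term_rel (f k)) (term_rel (union_term f s)) x y <->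
    term_rel (f k) x y \/ term_rel (union_term f s) x y.
  split=> [[[kxy|[sxy _]] _]|[kxy|sxy]]; [by left|by right|by split; left|].
  have [kxy|nkxy] := EM (term_rel (f k) x y); first by split; left.
  split; right; split=> // -[z kz]; apply: nkxy.
    by rewrite (funF _ _ _ (subF _ _ sxy) (kF _ _ kz)).
  by rewrite (injF _ _ _ (subF _ _ sxy) (kF _ _ kz)).
apply: iff_trans unionE _; split=> [[kxy|/IHs[k' k's k'xy]]|[k']].
- by exists k; rewrite ?mem_head.
- by exists k'; rewrite // inE k's orbT.
- by rewrite inE => /predU1P[->|k's k'xy]; [left|right; apply/IHs; exists k'].
Qed.

End Terms.

(** * Terms are injective and stay in one component *)

Section TermsToOperations.
Variable n : nat.
Implicit Types A : structure n.

Lemma term_injective A (t : term n) :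
  K_ipf A -> injective_pfun (@term_rel n A t).
Proof.
move=> KA; elim: t => [i|s [fs js] t [ft jt]|t _|s [fs js] t _|t [ft jt]
                      |s [fs js] t [ft jt]] /=.
- exact: KA.
- split=> x y z [u [xu uy]] [v [xv vz]].
  + by move: vz; rewrite -(fs _ _ _ xu xv); apply: ft.
  + by move: xu; rewrite (jt _ _ _ uy vz) => xu; apply: js xu xv.
- by split=> x y z [xy _] [xz _]; rewrite -?xy -?xz // xy xz.
- split=> x y z [xy _] [xz _]; [exact: fs xy xz|exact: js xy xz].
- split=> x y z xy xz; [exact: jt xy xz|exact: ft xy xz].
- rewrite /inj_union /rcap /pref_union /rconv.
  split=> x y z [[sxy|[txy nx]] [sxy'|[txy' ny]]] [[sxz|[txz mx]] [sxz'|[txz' mz]]];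
    by [exact: fs sxy sxz | exact: js sxy sxz | exact: ft txy txz
       | exact: jt txy txz | case: nx; exists z | case: mx; exists y
       | case: ny; exists x | case: mz; exists x| case: ny; exists y
       | case: mz; exists y | case: mx; exists z].
Qed.

(** Supplies the membership of the target in the component of the source that [op_induced]
    demands. *)
Lemma term_reachable A (t : term n) (x y : dom A) :
  term_rel t x y -> reachable x y.
Proof.
have sym (u v : dom A) : reachable u v -> reachable v u.
  elim=> [a b [i ab]|a|a b c _ ba _ cb]; [|exact: rt_refl|exact: rt_trans cb ba].
  by apply: rt_step; exists i; apply/or_comm.
elim: t x y => [i|s IHs t IHt|t IHt|s IHs t IHt|t IHt|s IHs t IHt] x y /=.
- by move=> xy; apply: rt_step; exists i; left.
- by move=> [z [/IHs xz /IHt zy]]; apply: rt_trans xz zy.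
- by move=> [<- _]; apply: rt_refl.
- by move=> [/IHs].
- by move=> /IHt/sym.
- by move=> [[/IHs|[/IHt]]].
Qed.

Lemma induced_component_embedding A (a : dom A) :
  component_embedding
    (@proj1_sig _ _ : dom (induced (reachable a)) -> dom A).
Proof.
split=> //.
- move=> [x ax] [y ay] /= xy; subst y.
  by rewrite (Prop_irrelevance ax ay).
- move=> [x ax] y xy /=.
  have ay : reachable a y by apply: rt_trans ax (rt_step _ _ _ _ xy).
  by exists (exist _ y ay).
Qed.

End TermsToOperations.

(** * From local first-order operations to terms *)

Section OperationsToTerms.
Variable n : nat.
Implicit Types A B : structure n.

(** Countably many disjoint copies of both structures: the game compares pairs of [A] and [B] inside
    one structure, and the copies make it rich. *)
Definition copies A B : structure n :=
  @Structure n (nat * (dom A + dom B)) (fun i x y =>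
    x.1 = y.1 /\
    match x.2, y.2 with
    | inl a, inl a' => rel_of (s := A) i a a'
    | inr b, inr b' => rel_of (s := B) i b b'
    | _, _ => False
    end).

Lemma copies_K A B : K_ipf A -> K_ipf B -> K_ipf (copies A B).
Proof.
move=> KA KB i; split=> -[k [x|x]] [k' [y|y]] [k'' [z|z]] //= [-> xy] [E xz] //.
- by rewrite E ((KA i).1 _ _ _ xy xz).
- by rewrite E ((KB i).1 _ _ _ xy xz).
- by rewrite E ((KA i).2 _ _ _ xy xz).
- by rewrite E ((KB i).2 _ _ _ xy xz).
Qed.

Lemma copies_inl A B k :
  component_embedding (fun x : dom A => (k, inl x) : dom (copies A B)).
Proof.
split=> [x y []|i x y|x [k' [y|y]]] //; first by split=> [|[]].
  by move=> [i [[/= <- _]|[/= -> _]]]; exists y.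
by move=> [i [[]|[]]].
Qed.

Lemma copies_inr A B k :
  component_embedding (fun x : dom B => (k, inr x) : dom (copies A B)).
Proof.
split=> [x y []|i x y|x [k' [y|y]]] //; first by split=> [|[]].
  by move=> [i [[]|[]]].
by move=> [i [[/= <- _]|[/= -> _]]]; exists y.
Qed.

Lemma word_embed A B (h : dom A -> dom B) w x y : component_embedding h ->
  word (A := A) w x y <-> word w (h x) (h y).
Proof.
move=> [injh relh closed].
have letterE l u v : letter (A := A) l u v <-> letter l (h u) (h v).
  by case: l => i []; apply: relh.
elim: w x => [|l w IHw] x /=; first by split=> [->|/injh].
split=> [[z [/letterE xz /IHw zy]]|[z' [xz zy]]]; first by exists (h z).
have [|z hz] := closed x z'.
  by case: l xz => i [] /= xz; exists i; [left|right].
by exists z; split; [apply/letterE|apply/IHw]; rewrite hz.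
Qed.

Lemma word_copy A B w (x y : dom (copies A B)) : word w x y -> x.1 = y.1.
Proof.
elim: w x => [|[i b] w IHw] x /=; first by move->.
by move=> [z [xz /IHw <-]]; case: b xz => -[].
Qed.

Lemma copies_rich A B : rich (copies A B).
Proof.
move=> m v [k c].
(* A copy index above those of all entries of [v]; words never change the index. *)
pose k' := (\max_(i < m) (v i).1).+1.
exists (k', c); split=> [w|i w /word_copy/= vi].
  case: c => c.
    by rewrite -(word_embed _ _ _ (copies_inl A B k))
               -(word_embed _ _ _ (copies_inl A B k')).
  by rewrite -(word_embed _ _ _ (copies_inr A B k))
             -(word_embed _ _ _ (copies_inr A B k')).
by have := leq_bigmax (F := fun i => (v i).1) i; rewrite vi ltnn.
Qed.

Definition pair_val (T : Type) (x y : T) : 'I_2 -> T :=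
  fun i => if i == ord0 then x else y.

Section Operation.
Variables (O : operation n) (p : fo n 2).
Hypothesis O_p : forall A (x y : dom A), O A x y <-> sat p (pair_val x y).
Hypothesis O_inj : injective_function_preserving O.
Hypothesis O_loc : local_over (@K_ipf n) O.
Let r := 3 ^ quantifier_depth p.

(** Locality moves both pairs into copy 0 of their structures in [copies A B], where the game
    applies. *)
Lemma op_similar A B (a b : dom A) (a' b' : dom B) : K_ipf A -> K_ipf B ->
  similar r (pair_val a b) (pair_val a' b') -> O A a b -> O B a' b'.
Proof.
move=> KA KB sim.
have KM := copies_K KA KB.
rewrite (embed_local (copies_inl A B 0) a b KA KM O_loc).
rewrite (embed_local (copies_inr A B 0) a' b' KB KM O_loc) !O_p.
apply: (similar_sat KM (@copies_rich A B) _).1 => i j w wr.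
have vl k : pair_val (0, inl a) (0, inl b) k =
    (0, inl (pair_val a b k)) :> dom (copies A B).
  by rewrite /pair_val; case: eqP.
have vr k : pair_val (0, inr a') (0, inr b') k =
    (0, inr (pair_val a' b' k)) :> dom (copies A B).
  by rewrite /pair_val; case: eqP.
rewrite !vl !vr -(word_embed _ _ _ (copies_inl A B 0)).
by rewrite -(word_embed _ _ _ (copies_inr A B 0)); apply: sim.
Qed.

(** If no short word joined [a] to [b], moving [b] from copy 0 to copy 1 would preserve similarity,
    and [O] would send one point to two. *)
Lemma op_near A (a b : dom A) : K_ipf A -> O A a b ->
  exists2 w, size w <= r & word w a b.
Proof.
move=> KA Oab; apply: contrapT => far.
have KM := copies_K KA KA.
pose c k (x : dom A) : dom (copies A A) := (k, inl x).
have Oc : O (copies A A) (c 0 a) (c 0 b).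
  by rewrite -(embed_local (copies_inl A A 0) a b KA KM O_loc).
suff Oc' : O (copies A A) (c 0 a) (c 1 b).
  by have [] := (O_inj KM).1 _ _ _ Oc Oc'.
apply/O_p; apply: (similar_sat KM (@copies_rich A A) _).1 ((O_p _ _).1 Oc).
have cE k x y w : word w (c k x) (c k y) <-> word w x y.
  by rewrite -(word_embed _ _ _ (copies_inl A A k)).
move=> i j w wr; rewrite /pair_val.
case: eqP => _; case: eqP => _; rewrite ?cE //.
- split=> [wab|/word_copy//]; by case: far; exists w.
- split=> [/word_invP wab|/word_copy//]; case: far.
  by exists (word_inv w); rewrite ?size_word_inv.
Qed.

(** Since [b] is the end of [w] from [a], every word of length at most [r] tested on the pair
    becomes, by conjugation, a loop test at [a] of length at most [3 * r]. *)
Lemma op_loops A B (a b : dom A) (a' b' : dom B) w : K_ipf A -> K_ipf B ->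
  size w <= r -> word w a b -> word w a' b' ->
  loops (3 * r) a = loops (3 * r) a' -> O A a b -> O B a' b'.
Proof.
move=> KA KB wr wab wab' eqL; apply: op_similar => //.
apply: (similar_paths (v := fun _ : 'I_1 => a) (v' := fun _ : 'I_1 => a')
  (g := fun _ => ord0) (p := fun i => if i == ord0 then [::] else w)) => //.
- move=> _ _ u ur; have /setP/(_ (Bseq ur)) := eqL.
  by rewrite !inE /=; apply: asbool_eq_equiv.
- by move=> k; case: eqP.
- by move=> k; rewrite /pair_val; case: eqP.
- by move=> k; rewrite /pair_val; case: eqP.
Qed.

Lemma op_term (i0 : 'I_n) : term_definable_over (@K_ipf n) O.
Proof.
pose I : finType :=
  ({set (3 * r).-bseq ('I_n * bool)} * r.-bseq ('I_n * bool))%type.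
(* Quantifying over all structures, and deciding the result classically, makes the list [s] and
   hence the term independent of the structure at hand. *)
pose good (k : I) := exists A (a b : dom A),
  [/\ K_ipf A, O A a b, loops (3 * r) a = k.1 & word k.2 a b].
pose f (k : I) := TComp (loops_term i0 k.1) (word_term i0 k.2).
pose s := [seq k <- enum I | `[<good k>]].
have fE (k : I) A (x y : dom A) :
    term_rel (f k) x y <-> loops (3 * r) x = k.1 /\ word k.2 x y.
  split=> [[z [/loops_termE[<- Lx] /word_termE xy]]|[Lx xy]] //.
  by exists x; split; [apply/loops_termE|apply/word_termE].
have s_good k : k \in s <-> good k.
  by rewrite mem_filter mem_enum andbT; split=> /asboolP.
exists (union_term i0 f s) => A KA x y.
have sO k u v : k \in s -> term_rel (f k) u v -> O A u v.
  move=> /s_good[B [a [b [KB Oab La wab]]]] /fE[Lu wuv].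
  by apply: op_loops wab wuv _ Oab => //; rewrite ?size_bseq // La Lu.
apply: iff_trans (iff_sym (union_termE i0 (O_inj KA) sO x y)).
split=> [Oxy|[k ks]]; last exact: sO.
have [w wr wxy] := op_near KA Oxy.
pose k : I := (loops (3 * r) x, Bseq wr).
by exists k; [apply/s_good; exists A, x, y|apply/fE].
Qed.

End Operation.
End OperationsToTerms.

Theorem theorem13 (n : nat) (hn : 0 < n) (O : operation n)
    (hO : fo_definable O) :
  (injective_function_preserving O /\ local_over (@K_ipf n) O) <->
  term_definable_over (@K_ipf n) O.
Proof.
split=> [[injO locO]|[t Ot]].
  by case: hO => p O_p; apply: (op_term O_p injO locO (Ordinal hn)).
split=> [A KA|A KA a b].
  have [funt injt] := term_injective t KA.
  split=> x y z /(Ot A KA) xy /(Ot A KA) xz; [exact: funt xy xz|exact: injt xy xz].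
have KI : K_ipf (induced (reachable a)).
  move=> i; have [funA injA] := KA i.
  have [injv _ _] := induced_component_embedding a.
  split=> x y z xy xz; apply: injv; [exact: funA xy xz|exact: injA xy xz].
have emb := embed_term (induced_component_embedding a) t.
rewrite (Ot A KA); split=> [tab|[ha [hb /(Ot _ KI)/emb]]] //.
exists (rt_refl _ _ _), (term_reachable tab).
by apply/(Ot _ KI)/emb.
Qed.
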